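(* There is a constant $c>0$ such that for every positive integer $d \ge 2$: the number of affine equivalence classes of $2$-level $d$-polytopes is at most $2^{c\, d^2\log d}$, and the number of linear equivalence classes of $2$-level $d$-cones is at most $2^{c\, d^2\log d}$. In other words, both numbers are $2^{O(d^2\log d)}$.
   Context: A polytope $P\subseteq\mathbb{R}^d$ (full-dimensional, i.e. a $d$-polytope) is \emph{$2$-level} if there exist a finite system of linear inequalities $Ax\ge b$ (with $A\in\mathbb{R}^{m\times d}$, $b\in\mathbb{R}^m$, rows $A_i$, no repeated inequalities) and a finite point set $V=\{v_1,\dots,v_n\}\subseteq\mathbb{R}^d$ such that $P=\{x\in\mathbb{R}^d: Ax\ge b\}=\mathrm{conv}(V)$ and $A_iv_j-b_i\in\{0,1\}$ for all $i\in[m]$, $j\in[n]$. Two polytopes are affinely equivalent if one is the image of the other under a bijective affine map of $\mathbb{R}^d$. A (pointed, polyhedral, full-dimensional) cone $K\subseteq\mathbb{R}^d$ is a \emph{$2$-level $d$-cone} if there exist a finite system $Ax\ge \mathbf{0}$ with $A\in\mathbb{R}^{m\times d}$ and a finite set $V=\{v_1,\dots,v_n\}\subseteq\mathbb{R}^d$ such that $K=\{x: Ax\ge\mathbf{0}\}=\mathrm{cone}(V)$ and $A_iv_j\in\{0,1\}$ for all $i,j$. Two cones are linearly equivalent if one is the image of the other under a non-singular linear map of $\mathbb{R}^d$. Logarithms are base $2$. *)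

(* Defs.v *)
From HB Require Import structures.
From mathcomp Require Import all_boot all_order all_algebra.
From mathcomp Require Import all_classical all_reals all_analysis.

Set Implicit Arguments.
Unset Strict Implicit.
Unset Printing Implicit Defensive.

Import Order.TTheory GRing.Theory Num.Theory.

Local Open Scope classical_set_scope.
Local Open Scope ring_scope.

Section Hulls.
Variables (R : realType) (d : nat).

(* A finite family [v_1, ..., v_n] of points of R^d is the matrix whose columns
   are the [v_j]; coefficient vectors are column vectors as well, so that
   [V *m l] is the combination [\sum_j l_j v_j]. *)

Definition conv_hull (n : nat) (V : 'M[R]_(d, n)) : set 'cV[R]_d :=
  [set x | exists l : 'cV[R]_n,
     [/\ forall j, 0 <= l j 0, \sum_j l j 0 = 1 & x = V *m l]].

Definition cone_hull (n : nat) (V : 'M[R]_(d, n)) : set 'cV[R]_d :=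
  [set x | exists l : 'cV[R]_n, (forall j, 0 <= l j 0) /\ x = V *m l].

Definition affine_hull (S : set 'cV[R]_d) : set 'cV[R]_d :=
  [set x | exists (n : nat) (V : 'M[R]_(d, n)) (l : 'cV[R]_n),
     [/\ forall j, S (col j V), \sum_j l j 0 = 1 & x = V *m l]].

Definition full_dimensional (S : set 'cV[R]_d) : Prop :=
  affine_hull S = [set: 'cV[R]_d].

Definition pointed (K : set 'cV[R]_d) : Prop :=
  K `&` [set x | K (- x)] = [set 0].

Definition polyhedron (m : nat) (A : 'M[R]_(m, d)) (b : 'cV[R]_m) :
    set 'cV[R]_d :=
  [set x | forall i, b i 0 <= (A *m x) i 0].

End Hulls.

Section TwoLevel.
Variables (R : realType) (d : nat).

Definition two_level_polytope (P : set 'cV[R]_d) : Prop :=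
  full_dimensional P /\
  exists (m n : nat) (A : 'M[R]_(m, d)) (b : 'cV[R]_m) (V : 'M[R]_(d, n)),
    [/\ injective (fun i => (row i A, b i 0)),
        P = polyhedron A b,
        P = conv_hull V
      & forall i j, (A *m V) i j - b i 0 = 0 \/ (A *m V) i j - b i 0 = 1].

Definition two_level_cone (K : set 'cV[R]_d) : Prop :=
  [/\ pointed K,
      full_dimensional K
    & exists (m n : nat) (A : 'M[R]_(m, d)) (V : 'M[R]_(d, n)),
        [/\ K = polyhedron A 0,
            K = cone_hull V
          & forall i j, (A *m V) i j = 0 \/ (A *m V) i j = 1]].

Definition affine_equivalent (P Q : set 'cV[R]_d) : Prop :=
  exists (M : 'M[R]_d) (t : 'cV[R]_d),
    bijective (fun x : 'cV[R]_d => M *m x + t) /\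
    Q = [set M *m x + t | x in P].

Definition linearly_equivalent (K L : set 'cV[R]_d) : Prop :=
  exists2 M : 'M[R]_d, M \in unitmx & L = [set M *m x | x in K].

End TwoLevel.

Definition equiv_classes (T : Type) (D : set T) (E : T -> T -> Prop) :
    set (set T) :=
  [set [set y | D y /\ E x y] | x in D].

Definition card_at_most (R : realType) (T : Type) (S : set T) (B : R) : Prop :=
  exists2 N : nat, (S #= `I_N)%card & N%:R <= B.

Definition log2 (R : realType) (x : R) : R := ln x / ln 2.

(* Main.v *)
(* Choosing coordinates among the rows of A (and, for a polytope, homogenising),
   a two-level object becomes the dual of the set F of all vectors a with
   a w in {0,1} for every w in a spanning set W of 0/1 vectors of R^k.  Two
   pieces of data determine F.
   (1) The lattice generated by W: k independent vectors of W generate a lattice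
   whose index in Z^k is at most k!, and each further generator at least halves
   the index, so k + log_2 k! vectors of W suffice.
   (2) A sum Q of matrices w w^T over a subset of W for which these matrices span
   the same space as for all of W; it has at most k^2 terms, so the entries of Q
   are at most k^2.
   If a is integral on the lattice, then (a w)^2 - a w >= 0 for w in W, so all
   these numbers vanish as soon as their sum, which is the value at Q of a linear
   form depending on a, does.  Both (1) and (2) take O(k^2 log k) bits. *)

Require Import Defs.
From mathcomp Require Import all_boot all_order all_algebra.
From mathcomp Require Import all_classical all_reals all_analysis.
From mathcomp Require Import perm ring lra.
Set Implicit Arguments.
Unset Strict Implicit.
Unset Printing Implicit Defensive.
Import Order.TTheory GRing.Theory Num.Theory.
Local Open Scope classical_set_scope.
Local Open Scope ring_scope.


(** * Generators of a lattice spanned by 0/1 vectors *)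

Lemma det_col_update (R : comPzRingType) (k : nat) (i : 'I_k) (t : 'cV[R]_k) :
  \det (\matrix_(p, q) if q == i then t p 0 else (p == q)%:R) = t i 0.
Proof.
rewrite (expand_det_row _ i) (bigD1 i) //= big1 ?addr0; last first.
  by move=> q qi; rewrite mxE (negPf qi) eq_sym (negPf qi) mul0r.
rewrite mxE eqxx /cofactor addnn -mul2n exprM sqrrN expr1n expr1n mul1r.
rewrite [X in \det X](_ : _ = 1%:M) ?det1 ?mulr1 //.
apply/matrixP=> p q; rewrite !mxE eq_sym (negPf (neq_lift i q)).
by rewrite (inj_eq (@lift_inj _ i)).
Qed.

Lemma det_int (R : archiNumDomainType) (k : nat) (B : 'M[R]_k) :
  (forall p q, B p q \is a Num.int) -> \det B \is a Num.int.
Proof.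
move=> Bint; rewrite rpred_sum // => s _; rewrite rpredM //.
  by rewrite rpredX // rpredN rpred1.
by rewrite rpred_prod.
Qed.

Lemma mulmx_int (R : archiNumDomainType) (m n p : nat)
    (A : 'M[R]_(m, n)) (B : 'M[R]_(n, p)) :
  (forall i j, A i j \is a Num.int) -> (forall i j, B i j \is a Num.int) ->
  forall i j, (A *m B) i j \is a Num.int.
Proof.
by move=> Aint Bint i j; rewrite mxE rpred_sum // => l _; rewrite rpredM.
Qed.

Lemma nearest_int (R : archiRealFieldType) (x : R) :
  {r : R | r \is a Num.int & `|x - r| <= 2^-1}.
Proof.
exists (Num.floor (x + 2^-1))%:~R; first exact: intr_int.
have := floor_itv (x + 2^-1); rewrite rmorphD /= => /andP[l u].
by rewrite ler_norml; apply/andP; split; lra.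
Qed.

(* The columns of [B] lie in the lattice generated by [(w_j)_(j in s)]; this
   is stated dually, so that no lattice has to be introduced. *)
Definition in_lattice (R : archiRealFieldType) (k n : nat)
    (W : 'M[R]_(k, n)) (s : seq 'I_n) (B : 'M[R]_k) :=
  forall a : 'rV[R]_k, {in s, forall j, (a *m W) 0 j \is a Num.int} ->
  forall i, (a *m B) 0 i \is a Num.int.

(** Induction on [e], a strict bound on the base-2 logarithm of [|\det B|]. If column [j] of [W] has
    a non-integral coordinate in the basis [B], reducing it modulo a basis column gives a
    replacement column that at least halves the determinant, at the cost of one generator. A nonzero
    integral determinant cannot drop below 1, so at most [e] replacements occur. *)
Lemma lattice_generators_ind (R : archiRealFieldType) (k n : nat)
    (W : 'M[R]_(k, n)) (Wint : forall i j, W i j \is a Num.int) (e : nat)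
    (s : seq 'I_n) (B : 'M[R]_k) :
  (forall i j, B i j \is a Num.int) -> in_lattice W s B ->
  \det B != 0 -> `|\det B| < 2 ^+ e ->
  exists2 s' : seq 'I_n, (size s' <= size s + e)%N &
    forall a : 'rV[R]_k, {in s', forall j, (a *m W) 0 j \is a Num.int} ->
      forall j, (a *m W) 0 j \is a Num.int.
Proof.
elim: e s B => [|e IHe] s B Bint sB B0 Be.
  have := norm_intr_ge1 (det_int Bint) B0.
  by rewrite leNgt -[X in _ < X](expr0 2) Be.
have Bu : B \in unitmx by rewrite unitmxE unitfE.
have [T WE] : exists T, W = B *m T by exists (invmx B *m W); rewrite mulKVmx.
have B1 p q : \sum_l B p l * (l == q)%:R = B p q.
  by rewrite -[RHS](congr1 (fun M : 'M[R]_k => M p q) (mulmx1 B)) mxE;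
    apply: eq_bigr => l _; rewrite mxE.
case: (pselect (forall i j, T i j \is a Num.int)) => [Tint|].
  exists s; first by rewrite leq_addr.
  move=> a sa j; rewrite WE mulmxA; apply: mulmx_int => // i l.
  by rewrite (ord1 i); apply: sB.
move=> /existsNP[i] /existsNP[j] Tij.
have [r rint rT] := nearest_int (T i j).
(* In [B]-coordinates, [t] is column [j] of [W] minus [r] times column [i] of [B]; [E] puts it in
   place of column [i]. *)
pose t : 'cV[R]_k := \col_p (T p j - r * (p == i)%:R).
pose E : 'M[R]_k := \matrix_(p, q) if q == i then t p 0 else (p == q)%:R.
have BE p q : (B *m E) p q = if q == i then W p j - r * B p i else B p q.
  rewrite mxE; case: (eqVneq q i) => [->|qi].
    under eq_bigr do rewrite !mxE eqxx mulrBr mulrCA.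
    by rewrite sumrB -mulr_sumr B1 WE mxE.
  by under eq_bigr do rewrite mxE (negPf qi); rewrite B1.
have detBE : \det (B *m E) = \det B * (T i j - r).
  by rewrite det_mulmx det_col_update mxE eqxx mulr1.
have Tr : T i j - r != 0 by apply: contra_notN Tij; rewrite subr_eq0 => /eqP->.
have [||||s' ss' s'P] := IHe (j :: s) (B *m E).
- by move=> p q; rewrite BE; case: ifP => // _; rewrite rpredB ?rpredM.
- move=> a sa q; have -> : (a *m (B *m E)) 0 q =
      if q == i then (a *m W) 0 j - r * (a *m B) 0 i else (a *m B) 0 q.
    rewrite mxE; under eq_bigr do rewrite BE.
    case: ifP => _; last by rewrite mxE.
    rewrite !mxE mulr_sumr -sumrB; apply: eq_bigr => l _.
    by rewrite mulrBr mulrCA.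
  have sB' : forall i, (a *m B) 0 i \is a Num.int.
    by apply: sB => l ls; rewrite sa // inE ls orbT.
  by case: ifP => // _; rewrite rpredB ?rpredM // sa // inE eqxx.
- by rewrite detBE mulf_neq0.
- rewrite detBE normrM -(ltr_pM2r (_ : 0 < 2)) // -exprSr.
  apply: le_lt_trans Be; rewrite -mulrA ler_piMr //; lra.
by exists s' => //; rewrite addnS -addSn.
Qed.

Lemma det_le_fact (R : numDomainType) (k : nat) (B : 'M[R]_k) :
  (forall i j, `|B i j| <= 1) -> `|\det B| <= k`!%:R.
Proof.
move=> B1; apply: le_trans (ler_norm_sum _ _ _) _.
rewrite -card_Sn -sumr_const; apply: ler_sum => s _.
rewrite normrM normrX normrN1 expr1n mul1r normr_prod.
by apply: prodr_ile1 => i _; rewrite normr_ge0 B1.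
Qed.

Definition bool_mx (R : pzSemiRingType) (m n : nat) (M : 'M[bool]_(m, n)) :
  'M[R]_(m, n) := map_mx (fun b : bool => b%:R) M.

(** The induction starts from [k] independent columns of [W], whose determinant is at most [k!] by
    the Leibniz expansion. *)
Lemma lattice_generators (R : archiRealFieldType) (k n e : nat)
    (W : 'M[bool]_(k, n)) (ke : (k`! < 2 ^ e)%N) : row_free (bool_mx R W) ->
  exists2 s : seq 'I_n, (size s <= k + e)%N &
    forall a : 'rV[R]_k,
      {in s, forall j, (a *m bool_mx R W) 0 j \is a Num.int} ->
      forall j, (a *m bool_mx R W) 0 j \is a Num.int.
Proof.
move=> Wfree.
have Wfull : row_full (bool_mx R W)^T by rewrite /row_full mxrank_tr.
pose f := fullrankfun Wfull.
pose B := (rowsub f (bool_mx R W)^T)^T.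
have BE p q : B p q = (W p (f q))%:R by rewrite !mxE.
have Bu : B \in unitmx by rewrite unitmx_tr fullrowsub_unit.
have [|||||s ss sP] :=
  @lattice_generators_ind R k n (bool_mx R W) _ e (codom f) B.
- by move=> i j; rewrite mxE; case: (W i j).
- by move=> i j; rewrite BE; case: (W i (f j)).
- move=> a sa i; have := sa (f i) (codom_f f i).
  by congr (_ \is a _); rewrite !mxE; apply: eq_bigr => l _; rewrite !mxE.
- by rewrite -unitfE -unitmxE.
- apply: (@le_lt_trans _ _ k`!%:R); last by rewrite -natrX ltr_nat.
  by apply: det_le_fact => i j; rewrite BE normr_nat lern1 leq_b1.
by exists s => //; rewrite size_codom card_ord in ss.
Qed.

(** * Encoding the set of binary forms *)

(* The generators of (1), padded with zero columns, and the matrix Q of (2). *)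
Definition code (k e : nat) : finType :=
  ('M[bool]_(k, k + e) * 'rV['I_(k * k).+1]_(k * k))%type.

(* For [w] a 0/1 vector, pairing [w w^T] with [a^T a - diag a] gives
   [(a w)^2 - a w]. *)
Definition decode (R : archiRealFieldType) (k e : nat) (c : code k e) :
    set 'rV[R]_k :=
  [set a | (forall j, (a *m bool_mx R c.1) 0 j \is a Num.int) /\
     map_mx (fun i : 'I_(k * k).+1 => i%:R) c.2
       *m (mxvec (a^T *m a - diag_mx a))^T = 0].

Arguments decode R {k e} c.

Definition binary_forms (R : pzSemiRingType) (k n : nat) (W : 'M[R]_(k, n)) :
    set 'rV[R]_k :=
  [set a | forall j, (a *m W) 0 j = 0 \/ (a *m W) 0 j = 1].

(** Row [j] is the flattened [w w^T] for column [w] of index [j]; Boolean entries make sums of rows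
    natural numbers. *)
Definition squares (k n : nat) (W : 'M[bool]_(k, n)) : 'M[bool]_(n, k * k) :=
  \matrix_j mxvec (\matrix_(p, q) (W p j && W q j)).

(** The pairing is the quadratic form [a^T a - diag a] evaluated at [w]; its diagonal part is linear
    in [w] because 0/1 entries equal their squares. *)
Lemma squares_mul (R : comPzRingType) (k n : nat) (W : 'M[bool]_(k, n))
    (a : 'rV[R]_k) (j : 'I_n) (x := (a *m bool_mx R W) 0 j) :
  (bool_mx R (squares W) *m (mxvec (a^T *m a - diag_mx a))^T) j 0 =
  x ^+ 2 - x.
Proof.
pose w := (col j (bool_mx R W))^T.
have -> : (bool_mx R (squares W) *m (mxvec (a^T *m a - diag_mx a))^T) j 0 =
  (mxvec (w^T *m w) *m (mxvec (a^T *m a - diag_mx a))^T) 0 0.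
  rewrite !mxE; apply: eq_bigr => l _; congr (_ * _).
  case/mxvec_indexP: l => p q.
  by rewrite !mxE !mxvecE !mxE big_ord1 !mxE -mulnb natrM.
rewrite mxvec_dotmul mulmxBr mulmxBl mxE [in X in _ + X]mxE; congr (_ - _).
- have wa : (a *m w^T) 0 0 = x.
    by rewrite /x !mxE; apply: eq_bigr => l _; rewrite !mxE.
  rewrite mulmxA -(mulmxA (w *m a^T)) mxE big_ord1 wa.
  by rewrite -[w in w *m a^T]trmxK -trmx_mul mxE wa expr2.
- rewrite mul_mx_diag /x !mxE; apply: eq_bigr => l _; rewrite !mxE.
  by rewrite mulrAC -natrM mulnb andbb mulrC.
Qed.

Lemma int_sqr_ge (R : archiRealDomainType) (x : R) :
  x \is a Num.int -> 0 <= x ^+ 2 - x.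
Proof.
move=> /intrP[z ->]; rewrite -rmorphXn /= subr_ge0 ler_int.
have [z0|z0] := leP z 0; first exact: le_trans z0 (sqr_ge0 _).
by rewrite expr2 ler_peMr // ltW.
Qed.

Lemma sqr_sub0 (R : idomainType) (x : R) : x ^+ 2 - x = 0 -> x = 0 \/ x = 1.
Proof.
move=> /eqP; rewrite expr2 -[X in _ - X]mulr1 -mulrBr mulf_eq0 subr_eq0.
by case/orP=> /eqP; [left|right].
Qed.

Lemma binary_forms_decode (R : archiRealFieldType) (k n e : nat)
    (W : 'M[bool]_(k, n)) (ke : (k`! < 2 ^ e)%N) : row_free (bool_mx R W) ->
  exists c : code k e, binary_forms (bool_mx R W) = decode R c.
Proof.
move=> Wfree; have [s ss sP] := lattice_generators ke Wfree.
pose G := bool_mx R (squares W).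
pose f := maxrankfun G.
pose q (l : 'I_(k * k)) := (\sum_i squares W (f i) l)%N.
(* There are [\rank G <= k * k] summands, each 0 or 1. *)
have qk l : (q l < (k * k).+1)%N.
  rewrite ltnS; apply: leq_trans (rank_leq_col G).
  apply: leq_trans (_ : \sum_(i < \rank G) 1 <= _)%N; last first.
    by rewrite sum1_card card_ord.
  by apply: leq_sum => i _; rewrite leq_b1.
have qE : map_mx (fun i : 'I_(k * k).+1 => i%:R) (\row_l inord (q l)) =
    const_mx 1 *m rowsub f G :> 'rV[R]_(k * k).
  apply/matrixP=> i l; rewrite !mxE inordK // natr_sum.
  by apply: eq_bigr => p _; rewrite !mxE mul1r.
(* Positions past the end of [s] read [None] and become zero columns, on which integrality is
   automatic. *)
exists (\matrix_(i, j) oapp (fun l => W i l) false (nth None (map Some s) j),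
        \row_l inord (q l)).
apply/seteqP; split=> a; rewrite /decode /binary_forms /=.
- move=> aW; split=> [j|].
    rewrite (_ : _ 0 j = oapp (fun l => (a *m bool_mx R W) 0 l) 0
                             (nth None (map Some s) j)).
      by case: (nth _ _ _) => [l|] //=; case: (aW l) => ->.
    rewrite mxE; case E : (nth _ _ _) => [l|] /=.
      by rewrite mxE; apply: eq_bigr => p _; rewrite !mxE E.
    by rewrite big1 // => p _; rewrite !mxE E mulr0.
  rewrite qE -mulmxA mul_rowsub_mx (_ : G *m _ = 0).
    rewrite (_ : rowsub f 0 = 0) ?mulmx0 //.
    by apply/matrixP=> i j; rewrite !mxE.
  apply/matrixP=> j z; rewrite (ord1 z) squares_mul [RHS]mxE.
  by case: (aW j) => ->; rewrite ?expr0n ?expr1n ?subrr ?subr0.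
- move=> [sa qa].
  have aint : forall j, (a *m bool_mx R W) 0 j \is a Num.int.
    apply: sP => j js.
    have js' : (index j s < k + e)%N by rewrite (leq_trans _ ss) // index_mem.
    rewrite (_ : _ 0 j = (a *m bool_mx R (\matrix_(i, j)
      oapp (fun l => W i l) false (nth None (map Some s) j)))
      0 (Ordinal js')) //.
    rewrite !mxE; apply: eq_bigr => p _; rewrite !mxE /=.
    by rewrite (nth_map j) ?index_mem // nth_index.
  set g := (mxvec _)^T in qa.
  (* The entries are nonnegative by integrality and add up to zero by [qa]. *)
  have G0 : rowsub f G *m g = 0.
    have xge0 (i : 'I_(\rank G)) : 0 <= (rowsub f G *m g) i 0.
      by rewrite mul_rowsub_mx mxE squares_mul int_sqr_ge.
    apply/matrixP=> i z; rewrite (ord1 z) [RHS]mxE.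
    apply: (psumr_eq0P (P := xpredT)
      (F := fun i => (rowsub f G *m g) i 0)) => //.
    rewrite qE -mulmxA in qa.
    transitivity (((const_mx 1 : 'rV[R]_(\rank G)) *m (rowsub f G *m g)) 0 0).
      rewrite [RHS]mxE; apply: eq_bigr => l _.
      by rewrite [const_mx 1 _ _]mxE mul1r.
    by rewrite qa mxE.
  (* The rows chosen by [f] span all rows of [G], so the vanishing extends to every column of
     [W]. *)
  have [X GX] : exists X, G = X *m rowsub f G.
    by apply/submxP; rewrite eq_maxrowsub.
  move=> j; apply: sqr_sub0; rewrite -squares_mul -/G -/g GX -mulmxA G0.
  by rewrite mulmx0 mxE.
Qed.

(** * Counting equivalence classes through codes *)

Lemma card_equiv_classes (T : Type) (C : finType) (D : set T)
    (E : T -> T -> Prop) (f : C -> T) :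
  (forall x y, E x y -> E y x) -> (forall x y z, E x y -> E y z -> E x z) ->
  (forall x, D x -> exists c, E x (f c)) ->
  exists2 N : nat, (equiv_classes D E #= `I_N)%card & (N <= #|C|)%N.
Proof.
move=> Esym Etrans fP.
(* [f c] need not satisfy [D], so its class is cut down to [D]. *)
pose g c := [set y | D y /\ E (f c) y].
pose h i := nth set0 (map g (enum C)) i.
have sub : equiv_classes D E `<=` h @` `I_#|C|.
  move=> _ [x Dx <-]; have [c xc] := fP x Dx; exists (enum_rank c) => /=.
    exact: ltn_ord.
  rewrite /h (nth_map c) -?cardE // nth_enum_rank.
  apply/seteqP; split=> y [Dy cy]; split=> //; first exact: Etrans cy.
  exact: Etrans (Esym _ _ xc) cy.
have cle := card_le_trans (subset_card_le sub) (card_image_le _ _).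
have [N EN] := (finite_setP _).1 (card_le_finite cle (finite_II _)).
by exists N => //; rewrite -card_le_II -(card_le_eql EN).
Qed.

Lemma kernel_row_full (F : fieldType) (m n : nat) (A : 'M[F]_(m, n)) :
  (forall x : 'cV[F]_n, A *m x = 0 -> x = 0) -> row_full A.
Proof.
move=> A0; suff : row_free A^T by rewrite /row_free mxrank_tr.
apply: inj_row_free => v vA; apply: trmx_inj; rewrite trmx0; apply: A0.
by rewrite -[A]trmxK -trmx_mul vA trmx0.
Qed.

Lemma row_mulE (R : pzSemiRingType) (m n p : nat) (A : 'M[R]_(m, n))
    (B : 'M[R]_(n, p)) (i : 'I_m) (j : 'I_p) :
  (row i A *m B) 0 j = (A *m B) i j.
Proof. by rewrite -row_mul mxE. Qed.

Lemma mulmx_colE (R : pzSemiRingType) (m n p : nat) (A : 'M[R]_(m, n))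
    (B : 'M[R]_(n, p)) (i : 'I_m) (j : 'I_p) :
  (A *m col j B) i 0 = (A *m B) i j.
Proof. by rewrite !mxE; apply: eq_bigr => k _; rewrite mxE. Qed.

(** * Linear and affine equivalence *)

Section Equivalences.
Variables (R : realType) (d : nat).

Lemma linearly_equivalent_sym (K L : set 'cV[R]_d) :
  linearly_equivalent K L -> linearly_equivalent L K.
Proof.
move=> [M Mu ->]; exists (invmx M); first by rewrite unitmx_inv.
apply/seteqP; split=> [x Kx|_ [_ [x Kx <-] <-]]; last by rewrite mulKmx.
by exists (M *m x); [exists x | rewrite mulKmx].
Qed.

Lemma linearly_equivalent_trans (K L J : set 'cV[R]_d) :
  linearly_equivalent K L -> linearly_equivalent L J -> linearly_equivalent K J.
Proof.
move=> [M Mu ->] [N Nu ->]; exists (N *m M); first by rewrite unitmx_mul Nu.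
by rewrite image_comp; apply: eq_imagel => x _ /=; rewrite mulmxA.
Qed.

Lemma affine_equivalentP (P Q : set 'cV[R]_d) :
  affine_equivalent P Q <->
  exists (M : 'M[R]_d) (t : 'cV[R]_d),
    M \in unitmx /\ Q = [set M *m x + t | x in P].
Proof.
split=> -[M [t [Mt QP]]]; exists M, t; split=> //.
  rewrite -row_full_unit; apply: kernel_row_full => x Mx.
  by apply: (bij_inj Mt); rewrite Mx mulmx0.
exists (fun y => invmx M *m (y - t)) => x; first by rewrite addrK mulKmx.
by rewrite mulKVmx // subrK.
Qed.

Lemma affine_equivalent_sym (P Q : set 'cV[R]_d) :
  affine_equivalent P Q -> affine_equivalent Q P.
Proof.
move=> /affine_equivalentP[M [t [Mu ->]]]; apply/affine_equivalentP.
have K x : invmx M *m (M *m x + t) + - (invmx M *m t) = x.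
  by rewrite mulmxDr addrK mulKmx.
exists (invmx M), (- (invmx M *m t)); split; first by rewrite unitmx_inv.
apply/seteqP; split=> [x Px|_ [_ [x Px <-] <-]]; last by rewrite K.
by exists (M *m x + t); [exists x | rewrite K].
Qed.

Lemma affine_equivalent_trans (P Q S : set 'cV[R]_d) :
  affine_equivalent P Q -> affine_equivalent Q S -> affine_equivalent P S.
Proof.
move=> /affine_equivalentP[M [t [Mu ->]]] /affine_equivalentP[N [u [Nu ->]]].
apply/affine_equivalentP; exists (N *m M), (N *m t + u).
split; first by rewrite unitmx_mul Nu.
by rewrite image_comp; apply: eq_imagel => x _ /=; rewrite mulmxDr mulmxA addrA.
Qed.

End Equivalences.

(** * Codes for two-level cones and polytopes *)

Section TwoLevelCodes.
Variables (R : realType) (d : nat).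

(** A linear form constant on [S] is constant on its affine hull, the whole space; evaluate it at
    the origin and at the unit vectors. *)
Lemma full_dimensional_form0 (S : set 'cV[R]_d) (v : 'rV[R]_d) (c : R) :
  full_dimensional S -> (forall x, S x -> (v *m x) 0 0 = c) -> v = 0 /\ c = 0.
Proof.
move=> fS Sc.
have vc (x : 'cV[R]_d) : (v *m x) 0 0 = c.
  have : affine_hull S x by rewrite fS.
  move=> [n [V [l [SV l1 ->]]]]; rewrite mulmxA mxE.
  rewrite -[RHS]mulr1 -l1 mulr_sumr; apply: eq_bigr => j _; congr (_ * _).
  by rewrite -(Sc _ (SV j)) !mxE; apply: eq_bigr => p _; rewrite mxE.
have c0 : c = 0 by rewrite -(vc 0) mulmx0 mxE.
split=> //; apply/rowP=> i; rewrite mxE -[RHS]c0 -(vc (delta_mx i 0)).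
by rewrite -colE mxE.
Qed.

Definition dual_cone (F : set 'rV[R]_d) : set 'cV[R]_d :=
  [set x | forall a, F a -> 0 <= (a *m x) 0 0].

(** The slice at height 1 of the dual cone in one dimension more. *)
Definition dual_polytope (F : set 'rV[R]_(d + 1)) : set 'cV[R]_d :=
  [set x | forall a, F a -> 0 <= (a *m col_mx x 1) 0 0].

Lemma binary_forms_ge0 (k n : nat) (W : 'M[R]_(k, n)) (a : 'rV[R]_k)
    (l : 'cV[R]_n) :
  binary_forms W a -> (forall j, 0 <= l j 0) -> 0 <= (a *m (W *m l)) 0 0.
Proof.
move=> aW l0; rewrite mulmxA mxE sumr_ge0 // => j _; rewrite mulr_ge0 //.
by case: (aW j) => ->.
Qed.

Lemma bool_mxP (m n : nat) (W : 'M[R]_(m, n)) :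
  (forall i j, W i j = 0 \/ W i j = 1) -> exists W0, W = bool_mx R W0.
Proof.
move=> W01; exists (\matrix_(i, j) (W i j == 1)); apply/matrixP=> i j.
by rewrite !mxE; case: (W01 i j) => ->; rewrite ?eqxx // eq_sym oner_eq0.
Qed.

(** The map [A0] turns the generators into 0/1 vectors [W]. The image of [K] is dual to the binary
    forms of [W]: each of these is nonnegative on the image, and the rows of [A], rewritten in the
    new coordinates, are among them. *)
Lemma two_level_cone_code (e : nat) (K : set 'cV[R]_d) : (d`! < 2 ^ e)%N ->
  two_level_cone K ->
  exists c : code d e, linearly_equivalent K (dual_cone (decode R c)).
Proof.
move=> de [pK fK [m [n [A [V [KA KV AV]]]]]].
(* The kernel of [A] lies in both [K] and [-K]. *)
have Afull : row_full A.
  apply: kernel_row_full => x Ax.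
  suff : (K `&` [set x | K (- x)]) x by rewrite pK.
  by rewrite KA /polyhedron; split=> i /=; rewrite ?mulmxN Ax !mxE ?oppr0.
pose f := fullrankfun Afull; pose A0 := rowsub f A.
have A0u : A0 \in unitmx by rewrite fullrowsub_unit.
have [i j|W WE] := @bool_mxP _ _ (A0 *m V); first by rewrite mul_rowsub_mx mxE.
have Wfree : row_free (bool_mx R W).
  rewrite -WE; apply: inj_row_free => v vV.
  have [||vA _] := @full_dimensional_form0 K (v *m A0) 0 => //.
    by rewrite KV => _ [l [_ ->]]; rewrite !mulmxA -(mulmxA v) vV mul0mx mxE.
  by rewrite -(mulmxK A0u v) vA mul0mx.
have [c cE] := binary_forms_decode de Wfree.
exists c; exists A0 => //; rewrite -cE -WE; apply/seteqP; split.
  move=> x xK; exists (invmx A0 *m x); last by rewrite mulKVmx.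
  rewrite KA => i; rewrite mxE.
  have := xK (row i A *m invmx A0); rewrite -mulmxA row_mulE; apply.
  by move=> j; rewrite -mulmxA mulKmx // row_mulE.
move=> _ [x Kx <-] a aW; rewrite KV in Kx; case: Kx => l [l0 ->].
by rewrite [A0 *m _]mulmxA binary_forms_ge0.
Qed.

(** A convex hull of finitely many points is bounded, so it contains no line: coordinate [i] never
    exceeds [B], whereas a suitable [t] would make it [B + 1]. *)
Lemma conv_hull_recession (n : nat) (V : 'M[R]_(d, n)) (p x : 'cV[R]_d) :
  (forall t : R, conv_hull V (p + t *: x)) -> x = 0.
Proof.
move=> Vp; apply/colP=> i; rewrite [RHS]mxE; apply/eqP.
apply: contraT => xi; pose B := \sum_j `|V i j|.
have bnd t : p i 0 + t * x i 0 <= B.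
  have [l [l0 l1 E]] := Vp t.
  have := congr1 (fun M : 'cV[R]_d => M i 0) E; rewrite !mxE => ->.
  apply: ler_sum => j _; apply: le_trans (ler_norm _) _.
  rewrite normrM ler_piMr // ger0_norm // -l1 (bigD1 j) //= lerDl.
  by rewrite sumr_ge0.
have := bnd ((B + 1 - p i 0) / x i 0).
by rewrite divfK // addrC subrK gerDl ler10.
Qed.

Lemma two_level_polytope_code (e : nat) (P : set 'cV[R]_d) :
  ((d + 1)`! < 2 ^ e)%N -> two_level_polytope P ->
  exists c : code (d + 1) e, affine_equivalent P (dual_polytope (decode R c)).
Proof.
move=> de [fP [m [n [A [b [V [_ PA PV AV]]]]]]].
(* On an empty [P] the zero form would vacuously have the constant value 1. *)
have [p Pp] : exists p, P p.
  apply: contrapT => /forallNP P0.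
  have [|_ /eqP] := @full_dimensional_form0 P 0 1 fP.
    by move=> x /P0.
  by rewrite oner_eq0.
have Afull : row_full A.
  apply: kernel_row_full => x Ax; apply: (@conv_hull_recession n V p) => t.
  rewrite -PV PA => i; rewrite mulmxDr -scalemxAr Ax scaler0 addr0.
  by move: Pp; rewrite PA.
pose f := fullrankfun Afull; pose A0 := rowsub f A; pose b0 := rowsub f b.
have A0u : A0 \in unitmx by rewrite fullrowsub_unit.
(* The slacks of the vertices in the chosen inequalities, homogenised by a row of ones. *)
pose W1 := col_mx (A0 *m V - b0 *m const_mx 1) (const_mx 1) : 'M[R]_(d + 1, n).
have W1l (l : 'cV[R]_n) : \sum_j l j 0 = 1 ->
    W1 *m l = col_mx (A0 *m (V *m l) - b0) 1.
  move=> l1; have ll : (const_mx 1 : 'rV[R]_n) *m l = 1.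
    apply/matrixP=> i j; rewrite (ord1 i) (ord1 j) !mxE eqxx -[RHS]l1.
    by apply: eq_bigr => q _; rewrite mxE mul1r.
  by rewrite mul_col_mx ll mulmxBl -[b0 *m _ *m l]mulmxA ll mulmx1 mulmxA.
have [i j|W WE] := @bool_mxP _ _ W1.
  rewrite /W1; case: (split_ordP i) => q ->; rewrite ?col_mxEu ?col_mxEd.
    by have := AV (f q) j; rewrite mul_rowsub_mx !mxE big_ord1 !mxE mulr1.
  by rewrite mxE; right.
have Wfree : row_free (bool_mx R W).
  rewrite -WE; apply: inj_row_free => u uW.
  rewrite -[u]hsubmxK.
  (* A relation [u] among the rows of [W1] is an affine function vanishing on [P]. *)
  have [|vA] := @full_dimensional_form0 P (lsubmx u *m A0)
      ((lsubmx u *m b0) 0 0 - rsubmx u 0 0) fP.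
    rewrite PV => _ [l [_ l1 ->]].
    have : (u *m (W1 *m l)) 0 0 = 0 by rewrite mulmxA uW mul0mx mxE.
    rewrite W1l // -{1}[u]hsubmxK mul_row_col mulmx1 mulmxBr (mulmxA _ A0).
    set x1 := _ *m (V *m l); set x2 := _ *m b0.
    by rewrite mxE [(x1 - x2) 0 0]mxE [(- x2) 0 0]mxE => ?; lra.
  have -> : lsubmx u = 0 by rewrite -(mulmxK A0u (lsubmx u)) vA mul0mx.
  rewrite mul0mx mxE sub0r => /eqP; rewrite oppr_eq0 => /eqP ru.
  rewrite (_ : rsubmx u = 0) ?row_mx0 //.
  by apply/matrixP=> i j; rewrite (ord1 i) (ord1 j) ru mxE.
have [c cE] := binary_forms_decode de Wfree.
exists c; apply/affine_equivalentP; exists A0, (- b0); split=> //.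
rewrite -cE -WE; apply/seteqP; split.
  move=> y yK; exists (invmx A0 *m (y + b0)); last by rewrite mulKVmx // addrK.
  rewrite PA => i; pose g := row i A *m invmx A0.
  have gE x : row_mx g (g *m b0 - (b i 0)%:M) *m col_mx x 1 =
      g *m (x + b0) - (b i 0)%:M.
    by rewrite mul_row_col mulmx1 addrA mulmxDr.
  (* This form is inequality [i] of [P] in the coordinates [A0 x - b0], homogenised. *)
  have := yK (row_mx g (g *m b0 - (b i 0)%:M)).
  have formE (z : 'cV[R]_d) : (g *m z - (b i 0)%:M) 0 0 =
      (A *m (invmx A0 *m z)) i 0 - b i 0.
    by rewrite mxE /g -mulmxA row_mulE !mxE mulr1n.
  rewrite gE formE subr_ge0; apply=> j.
  rewrite (_ : _ 0 j = (A *m V) i j - b i 0) //.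
  have := W1l (delta_mx j 0); rewrite -!colE => W1j.
  transitivity ((row_mx g (g *m b0 - (b i 0)%:M) *m col j W1) 0 0).
    by rewrite mulmx_colE.
  rewrite W1j; last first.
    rewrite (bigD1 j) //= big1 ?addr0 ?mxE ?eqxx // => q qj.
    by rewrite mxE (negPf qj).
  by rewrite gE subrK formE mulKmx // mulmx_colE.
move=> _ [x Px <-] a aW; rewrite PV in Px; case: Px => l [l0 l1 ->].
by rewrite -W1l // binary_forms_ge0.
Qed.

End TwoLevelCodes.

(** * Size of the codes *)

Lemma fact_lt_exp2 (k L : nat) : (0 < k)%N -> (k < 2 ^ L)%N ->
  (k`! < 2 ^ (k * L))%N.
Proof.
move=> k0 kL; rewrite mulnC expnM.
apply: (@leq_ltn_trans (k ^ k)); last by rewrite ltn_exp2r.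
suff H j : (j <= k)%N -> (j`! <= k ^ j)%N by exact: H.
by elim: j => // j IHj jk; rewrite factS expnS leq_mul // IHj // ltnW.
Qed.

(** The Boolean matrix takes [k * (k + k * L)] bits, and each of the [k * k] numbers takes [2 * L]
    bits since [k^2 + 1 <= (k + 1)^2]. *)
Lemma card_code_le (k L : nat) : (k < 2 ^ L)%N ->
  (#|code k (k * L)| <= 2 ^ (k * k * (1 + 3 * L)))%N.
Proof.
move=> kL; rewrite card_prod !card_mx card_bool card_ord mul1n.
have sqL : ((k * k).+1 <= 2 ^ (2 * L))%N.
  rewrite mulnC expnM; apply: (@leq_trans (k.+1 ^ 2)); last first.
    by rewrite leq_exp2r.
  by rewrite -mulnn mulSn mulnS addnA addSn ltnS leq_addl.
apply: (@leq_trans (2 ^ (k * (k + k * L)) * (2 ^ (2 * L)) ^ (k * k))).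
  rewrite leq_mul2l; apply/orP; right.
  by case: (posnP (k * k)) => [->//|kk]; rewrite leq_exp2r.
by rewrite -expnM -expnD leq_exp2l //; apply: eq_leq; ring.
Qed.

Lemma trunc_log_le_log2 (R : realType) (d : nat) : (0 < d)%N ->
  (trunc_log 2 d)%:R <= log2 d%:R :> R.
Proof.
move=> d0; rewrite /log2 ler_pdivlMr ?ln_gt0 ?ltr1n //.
rewrite mulr_natl -lnXn // ler_ln ?posrE ?exprn_gt0 ?ltr0n //.
by rewrite -natrX ler_nat trunc_logP.
Qed.

(** The constant is [40 = 4 * 10]: [k <= 2 d] gives [k^2 <= 4 d^2], and [1 + 3 L], which is 7 plus
    three times the truncated logarithm, is at most [10 log2 d] because [log2 d >= 1]. *)
Lemma card_at_most_code (R : realType) (T : Type) (S : set T) (d k N : nat)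
    (L := (trunc_log 2 d).+2) :
  (2 <= d)%N -> (k <= d + 1)%N -> (S #= `I_N)%card ->
  (N <= #|code k (k * L)|)%N ->
  card_at_most S (2 `^ (40 * d%:R ^+ 2 * log2 d%:R) : R).
Proof.
move=> d2 kd SN NC; exists N => //.
have d0 : (0 < d)%N by apply: leq_trans d2.
have kL : (k < 2 ^ L)%N.
  apply: leq_ltn_trans kd _; rewrite addn1.
  by apply: leq_ltn_trans (@trunc_log_ltn 2 d isT) _; rewrite ltn_exp2l.
apply: (@le_trans _ _ (2 ^ (k * k * (1 + 3 * L)))%:R).
  by rewrite ler_nat (leq_trans NC) // card_code_le.
rewrite natrX -[leLHS]powR_mulrn //; apply: ler_powR; first by rewrite ler1n.
have tl := @trunc_log_le_log2 R d d0.
have l1 : 1 <= log2 d%:R :> R.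
  by apply: le_trans tl; rewrite ler1n trunc_log_gt0.
have LE : (1 + 3 * L)%:R <= 10 * log2 d%:R :> R.
  rewrite natrD natrM /L -addn2 natrD; lra.
apply: (@le_trans _ _ ((4 * d%:R ^+ 2) * (10 * log2 d%:R))); last first.
  by rewrite le_eqVlt; apply/orP; left; apply/eqP; ring.
rewrite natrM ler_pM // -natrX -natrM ler_nat.
apply: (@leq_trans ((2 * d) * (2 * d))); last by rewrite mulnACA mulnn.
have k2 : (k <= 2 * d)%N by rewrite (leq_trans kd) // mul2n -addnn leq_add2l.
exact: leq_mul.
Qed.

Theorem theorem1p1 (R : realType) :
  exists c : R, 0 < c /\
    forall d : nat, (2 <= d)%N ->
      card_at_most
        (equiv_classes (@two_level_polytope R d) (@affine_equivalent R d))
        (2 `^ (c * d%:R ^+ 2 * log2 d%:R)) /\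
      card_at_most
        (equiv_classes (@two_level_cone R d) (@linearly_equivalent R d))
        (2 `^ (c * d%:R ^+ 2 * log2 d%:R)).
Proof.
exists 40; split=> [|d d2]; first by rewrite ltr0n.
(* The successor of the truncated logarithm only gives [d < 2 ^ L]; one more covers the homogenised
   dimension [d + 1]. *)
pose L := (trunc_log 2 d).+2.
have dL : (d + 1 < 2 ^ L)%N.
  rewrite addn1; apply: leq_ltn_trans (@trunc_log_ltn 2 d isT) _.
  by rewrite ltn_exp2l.
split.
- have [|N SN NC] := @card_equiv_classes _ (code (d + 1) ((d + 1) * L))
    (@two_level_polytope R d) _ (fun c => dual_polytope (decode R c))
    (@affine_equivalent_sym R d) (@affine_equivalent_trans R d).
    move=> P; apply: two_level_polytope_code; apply: fact_lt_exp2 dL.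
    by rewrite addn1.
  exact: card_at_most_code d2 _ SN NC.
- have [|N SN NC] := @card_equiv_classes _ (code d (d * L))
    (@two_level_cone R d) _ (fun c => dual_cone (decode R c))
    (@linearly_equivalent_sym R d) (@linearly_equivalent_trans R d).
    move=> K; apply: two_level_cone_code; apply: fact_lt_exp2 (ltn_trans _ dL).
      exact: leq_trans d2.
    by rewrite addn1.
  by apply: card_at_most_code d2 _ SN NC; rewrite leq_addr.
Qed.
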